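(* Let $p$ be an odd prime and $n$ a positive integer, and let $a_k,b_k\in\mathbb{Q}\cap\mathbb{Z}_p$ for $k=1,\ldots,n$. Let $d$ be a positive integer with $p\equiv -1\pmod d$. Then for every $t\in\mathbb{F}_p$, \[ {}_{n+2}G_{n+2}\left[\begin{array}{ccccc} a_1, & \ldots, & a_n, & \frac{1}{d}, & \frac{d-1}{d}\\ b_1, & \ldots, & b_n, & \frac{1}{d}, & \frac{d-1}{d}\end{array}\Big| t\right]_p={}_nG_n\left[\begin{array}{ccc} a_1, & \ldots, & a_n\\ b_1, & \ldots, & b_n\end{array}\Big| t\right]_p. \]
   Context: Let $p$ be an odd prime, $q=p^r$ with $r\ge 1$ (here $r=1$, $q=p$), and $\mathbb{F}_q$ the field with $q$ elements. Let $\mathbb{Z}_q$ be the ring of integers of the unramified extension of $\mathbb{Q}_p$ with residue field $\mathbb{F}_q$. Let $\omega:\mathbb{F}_q^\times\to\mathbb{Z}_q^\times$ be the Teichmüller character ($\omega(a)$ is the unique $(q-1)$-th root of unity with $\omega(a)\equiv a\pmod p$), $\overline{\omega}=\omega^{-1}$, and every multiplicative character (including the trivial one) is extended to $\mathbb{F}_q$ by value $0$ at $0$. $\Gamma_p$ is Morita's $p$-adic gamma function. For $x\in\mathbb{Q}$, $\lfloor x\rfloor$ is the floor and $\langle x\rangle=x-\lfloor x\rfloor$. For a positive integer $m$, $a_k,b_k\in\mathbb{Q}\cap\mathbb{Z}_p$ and $t\in\mathbb{F}_q$, \[ {}_mG_m\left[\begin{array}{ccc} a_1, & \ldots, & a_m\\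 b_1, & \ldots, & b_m\end{array}\Big| t\right]_q:=\frac{-1}{q-1}\sum_{a=0}^{q-2}(-1)^{am}\,\overline{\omega}^a(t)\prod_{k=1}^m\prod_{i=0}^{r-1}(-p)^{-\lfloor\langle a_kp^i\rangle-\frac{ap^i}{q-1}\rfloor-\lfloor\langle -b_kp^i\rangle+\frac{ap^i}{q-1}\rfloor}\frac{\Gamma_p(\langle (a_k-\frac{a}{q-1})p^i\rangle)}{\Gamma_p(\langle a_kp^i\rangle)}\frac{\Gamma_p(\langle (-b_k+\frac{a}{q-1})p^i\rangle)}{\Gamma_p(\langle -b_kp^i\rangle)}. \]
   Formalization: The formal statement requires d > 2 instead of d positive: for d = 1 and d = 2 the identity is false (for example p = 3, n = 1, a_1 = b_1 = 0, t = 1), since the extra columns multiply some terms by p^2 or p^{-2}. *)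

(* Defs.v *)
From HB Require Import structures.
From mathcomp Require Import all_boot all_order all_algebra.
From mathcomp Require Import zify boolp classical_sets.

Set Implicit Arguments.
Unset Strict Implicit.
Unset Printing Implicit Defensive.

Import Order.TTheory GRing.Theory Num.Theory.

Local Open Scope ring_scope.

(* Z_p as the inverse limit of the rings Z/p^n: a p-adic integer x is the
   sequence of the canonical representatives 0 <= x n < p^n of x mod p^n. The
   proof that p is prime is a parameter of the type because the integral domain
   structure needs it. *)
Record padic_int (p : nat) (p_pr : prime p) := PadicInt {
  padic_res :> nat -> int;
  padic_resP : forall n, (padic_res n.+1 %% (p ^ n)%N%:Z)%Z = padic_res n }.

Section PadicInt.

Variables (p : nat) (p_pr : prime p).

Local Notation Zp := (padic_int p_pr).
Local Notation "'q_ n" := ((p ^ n)%N%:Z) (at level 8, n at level 2).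

HB.instance Definition _ := gen_eqMixin Zp.
HB.instance Definition _ := gen_choiceMixin Zp.

Implicit Types x y z : Zp.

Lemma padicP x y : (forall n, x n = y n) -> x = y.
Proof.
case: x y => [f hf] [g hg] /= fg.
have {}fg : f = g by apply/funext.
by case: g / fg hg => hg; congr PadicInt; exact: Prop_irrelevance.
Qed.

Lemma padic_modD (m : int) n k : ((m %% 'q_(k + n))%Z = m %[mod 'q_n])%Z.
Proof.
rewrite [in RHS](divz_eq m 'q_(k + n)) expnD PoszM mulrA addrC.
by rewrite -[RHS]modzDmr modzMl addr0.
Qed.

Lemma padic_modS (m : int) n : ((m %% 'q_n.+1)%Z = m %[mod 'q_n])%Z.
Proof. exact: (padic_modD m n 1). Qed.

Lemma padic_res_mod x n : (x n %% 'q_n)%Z = x n.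
Proof. by rewrite -[in LHS](padic_resP x) modz_mod padic_resP. Qed.

Lemma padic_resD x n k : (x (k + n)%N %% 'q_n)%Z = x n.
Proof.
elim: k => [|k IH]; first exact: padic_res_mod.
by rewrite -IH -(padic_resP x (k + n)) padic_modD.
Qed.

Lemma padic_of_subproof (f : nat -> int) :
  (forall n, f n.+1 = f n %[mod 'q_n])%Z ->
  forall n, ((f n.+1 %% 'q_n.+1)%Z %% 'q_n)%Z = (f n %% 'q_n)%Z.
Proof. by move=> hf n; rewrite padic_modS. Qed.

Definition padic_of f hf : Zp := PadicInt p_pr (@padic_of_subproof f hf).

Lemma padic_res_eqmod x n : (x n.+1 = x n %[mod 'q_n])%Z.
Proof. by rewrite padic_resP padic_res_mod. Qed.

Definition padic_zero : Zp := @padic_of (fun=> 0) (fun=> erefl).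

Definition padic_one : Zp := @padic_of (fun=> 1) (fun=> erefl).

Lemma padic_opp_subproof x n : (- x n.+1 = - x n %[mod 'q_n])%Z.
Proof. by rewrite -modzNm padic_resP. Qed.

Definition padic_opp x : Zp := padic_of (padic_opp_subproof x).

Lemma padic_add_subproof x y n :
  (x n.+1 + y n.+1 = x n + y n %[mod 'q_n])%Z.
Proof. by rewrite -modzDm !padic_resP. Qed.

Definition padic_add x y : Zp := padic_of (padic_add_subproof x y).

Lemma padic_mul_subproof x y n :
  (x n.+1 * y n.+1 = x n * y n %[mod 'q_n])%Z.
Proof. by rewrite -modzMm !padic_resP. Qed.

Definition padic_mul x y : Zp := padic_of (padic_mul_subproof x y).

Lemma padic_addA : associative padic_add.
Proof. by move=> x y z; apply: padicP => n /=; rewrite modzDmr modzDml addrA. Qed.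

Lemma padic_addC : commutative padic_add.
Proof. by move=> x y; apply: padicP => n /=; rewrite addrC. Qed.

Lemma padic_add0 : left_id padic_zero padic_add.
Proof. by move=> x; apply: padicP => n /=; rewrite mod0z add0r padic_res_mod. Qed.

Lemma padic_addN : left_inverse padic_zero padic_opp padic_add.
Proof. by move=> x; apply: padicP => n /=; rewrite modzDml addNr mod0z. Qed.

HB.instance Definition _ :=
  GRing.isZmodule.Build Zp padic_addA padic_addC padic_add0 padic_addN.

Lemma padic_mulA : associative padic_mul.
Proof. by move=> x y z; apply: padicP => n /=; rewrite modzMmr modzMml mulrA. Qed.

Lemma padic_mulC : commutative padic_mul.
Proof. by move=> x y; apply: padicP => n /=; rewrite mulrC. Qed.

Lemma padic_mul1 : left_id padic_one padic_mul.
Proof.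
by move=> x; apply: padicP => n /=; rewrite modzMml mul1r padic_res_mod.
Qed.

Lemma padic_mulD : left_distributive padic_mul padic_add.
Proof.
by move=> x y z; apply: padicP => n /=; rewrite modzMml modzDm mulrDl.
Qed.

Lemma padic_1neq0 : padic_one != padic_zero.
Proof.
apply/eqP => /(congr1 (fun x : Zp => x 1%N)) /=.
by rewrite mod0z modz_small // expn1 ltz_nat prime_gt1.
Qed.

HB.instance Definition _ := GRing.Zmodule_isComNzRing.Build Zp
  padic_mulA padic_mulC padic_mul1 padic_mulD padic_1neq0.

Definition padic_unit : pred Zp := fun x => `[< exists y, y * x = 1 >].

Definition padic_inv x : Zp := xget x [set y | y * x = 1]%classic.

Lemma padic_mulVx : {in padic_unit, left_inverse 1 padic_inv *%R}.
Proof. by move=> x /asboolP hx; exact: xgetPex hx. Qed.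

Lemma padic_unitPl x y : y * x = 1 -> padic_unit x.
Proof. by move=> h; apply/asboolP; exists y. Qed.

Lemma padic_inv_out : {in [predC padic_unit], padic_inv =1 id}.
Proof.
move=> x /asboolPn hx; rewrite /padic_inv; case: xgetP => // y _ /= hy.
by case: hx; exists y.
Qed.

HB.instance Definition _ := GRing.ComNzRing_hasMulInverse.Build Zp
  padic_mulVx padic_unitPl padic_inv_out.

Lemma padic_neq0 x : x != 0 -> exists n, x n != 0.
Proof.
move=> x0; apply: contrapT => hx; case/eqP: x0; apply: padicP => n /=.
by rewrite mod0z; apply/eqP; apply: contrapT => /negP xn; apply: hx; exists n.
Qed.

Lemma padic_mulf_eq0 : GRing.integral_domain_axiom Zp.
Proof.
move=> x y xy0; apply/norP => -[/padic_neq0[m xm] /padic_neq0[n yn]].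
have := congr1 (fun z : Zp => z (m + n)%N) xy0 => /= /eqP.
rewrite mod0z => /eqP/eqP hxy.
have nd (z : Zp) k l : z k != 0 -> ~~ ('q_k %| z (l + k)%N)%Z.
  by move=> zk; apply/negP => /dvdz_mod0P; rewrite padic_resD; apply/eqP.
have {xm} := nd x m n xm; have {yn} := nd y n m yn.
rewrite [(n + m)%N]addnC; move: hxy => /eqP/dvdz_mod0P.
move: (x _) (y _) => a b; rewrite !dvdzE /= abszM.
have [|a0] := posnP `|a|%N; first by move=> ->; rewrite dvdn0.
have [|b0] := posnP `|b|%N; first by move=> -> ; rewrite dvdn0.
rewrite !pfactor_dvdn ?muln_gt0 ?a0 // lognM // -!ltnNge.
by move=> h1 h2 h3; have := leq_add h3 h2; rewrite addnS; lia.
Qed.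

HB.instance Definition _ :=
  GRing.ComUnitRing_isIntegral.Build Zp padic_mulf_eq0.

End PadicInt.

Notation padic_field p_pr := {fraction padic_int p_pr}.

Definition fracQ (x : rat) : rat := x - (Num.floor x)%:~R.

Section HypergeometricG.

Variables (p : nat) (p_pr : prime p).

Local Notation Zp := (padic_int p_pr).
Local Notation Qp := (padic_field p_pr).
Local Notation "x %:F" := (tofrac x).

Definition rat_in_Zp (x : rat) : Prop := exists z : Zp, z%:F = ratr x :> Qp.

Definition morita_nat (n : nat) : Zp :=
  (-1) ^+ n * \prod_(1 <= j < n | ~~ (p %| j)%N) j%:R.

(* The limit of morita_nat n as the natural number n tends p-adically to x
   (equality of the m-th residues is congruence mod p^m). For odd p it exists
   and is unique, so the default value 0 is never used. *)
Definition morita_gamma (x : Zp) : Zp :=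
  xget 0 [set l : Zp | forall k, exists m, forall n : nat,
    (n%:R : Zp) m = x m -> morita_nat n k = l k]%classic.

(* In Z_p, ratr x is the quotient numq x / denq x, so this is the value of the
   gamma function at x as soon as p does not divide the denominator of x. *)
Definition gammaQ (x : rat) : Qp := (morita_gamma (ratr x))%:F.

Definition teichmuller (t : 'F_p) : Zp :=
  xget 0 [set z : Zp | z ^+ p.-1 = 1 /\ (z 1%N)%:~R = t]%classic.

Definition teichmuller_bar (j : nat) (t : 'F_p) : Qp :=
  if t == 0 then 0 else ((teichmuller t)%:F)^-1 ^+ j.

(* The function mGm over F_p; the general one, over F_(p^r), has an inner
   product over 0 <= i < r, which reduces here to the factor i = 0. *)
Definition mGm (m : nat) (a b : m.-tuple rat) (t : 'F_p) : Qp :=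
  (-1) / (p.-1)%:R *
  \sum_(0 <= j < p.-1)
    (-1) ^+ (j * m) * teichmuller_bar j t *
    \prod_(k < m)
      let ak := tnth a k in
      let bk := tnth b k in
      let x : rat := j%:R / (p.-1)%:R in
      (- p%:R) ^ (- Num.floor (fracQ ak - x) - Num.floor (fracQ (- bk) + x)) *
      (gammaQ (fracQ (ak - x)) / gammaQ (fracQ ak)) *
      (gammaQ (fracQ (- bk + x)) / gammaQ (fracQ (- bk))).

End HypergeometricG.

(* Main.v *)
(* Each term of the longer sum is a term of the shorter one times the factors
   of the two extra parameter pairs, and these multiply to 1. With
   x = j / (p - 1), the numbers 1/d - x and -1/d - x are not integers because
   d > 2 divides p + 1, so the powers of -p cancel and the gamma values pair up
   as Gamma(u) Gamma(1 - u), with u the fractional part of 1/d - x or of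
   -1/d - x. By the reflection formula
   Gamma(y) Gamma(1 - y) = (-1)^a0, where 1 <= a0 <= p and a0 = y mod p,
   only a sign remains, and its exponent is even. The reflection formula comes
   from Gamma(n + 1) = - n Gamma(n) (or - Gamma(n) if p | n), together with
   Gamma(p^k) = 1 mod p^k, the generalization of Wilson's theorem. *)
Require Import Defs.
From mathcomp Require Import all_boot all_order all_algebra.
From mathcomp Require Import zify ring lra classical_sets.

Set Implicit Arguments.
Unset Strict Implicit.
Unset Printing Implicit Defensive.

Import Order.TTheory GRing.Theory Num.Theory.

Local Open Scope ring_scope.

(** * Residues, periodic products and products over an extended parameter list *)

Lemma intr_Zp_eq0 (q : nat) (z : int) : (1 < q)%N ->
  ((z%:~R : 'Z_q) == 0) = (q %| z)%Z.
Proof.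
move=> q1.
have nat_eq0 (m : nat) : ((m%:R : 'Z_q) == 0) = (q %| m)%N.
  by rewrite -val_eqE /= val_Zp_nat.
case: z => m; rewrite dvdzE /= ?NegzE ?mulrNz ?oppr_eq0; exact: nat_eq0.
Qed.

Lemma prod_periodic (R : comNzRingType) (f : nat -> R) (m k : nat) :
  (forall i, f (i + m)%N = f i) ->
  \prod_(0 <= i < m * k) f i = (\prod_(0 <= i < m) f i) ^+ k.
Proof.
move=> fm; have fmk j i : f (i + m * j)%N = f i.
  by elim: j => [|j IH]; rewrite ?muln0 ?addn0 // mulnSr addnA fm.
elim: k => [|k IH]; first by rewrite muln0 big_geq.
rewrite mulnSr (@big_cat_nat _ _ _ (m * k)) ?leq_addr //= IH exprSr.
congr (_ * _); rewrite -{1}[(m * k)%N]add0n big_addn addnC addnK.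
by apply: eq_bigr => i _; rewrite fmk.
Qed.

Lemma prod_cat_tuple2 (R : comNzRingType) (T : Type) (F : T -> T -> R)
    (n : nat) (a b : n.-tuple T) (c d : T) :
  \prod_(k < n + 2) F (tnth (cat_tuple a [tuple c; d]) k)
                      (tnth (cat_tuple b [tuple c; d]) k) =
  \prod_(k < n) F (tnth a k) (tnth b k) * (F c c * F d d).
Proof.
rewrite big_split_ord /= big_ord_recl big_ord1 !tnth_rshift; congr (_ * _).
by apply: eq_bigr => k _; rewrite !tnth_lshift.
Qed.

Lemma signr_mulnD2 (R : nzRingType) (j n : nat) :
  (-1) ^+ (j * (n + 2)) = (-1) ^+ (j * n) :> R.
Proof. by rewrite mulnDr exprD [(j * 2)%N]mulnC (exprM _ 2) sqrrN !expr1n mulr1. Qed.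

Lemma eqmod_small_pos (p x y : nat) :
  (0 < x <= p)%N -> (0 < y <= p)%N -> (x = y %[mod p])%N -> x = y.
Proof.
move: x y => [|x] [|y] //= xp yp /eqP.
by rewrite -[x.+1]addn1 -[y.+1]addn1 eqn_modDr !modn_small // => /eqP ->.
Qed.

(** * Morita's gamma function at natural numbers, modulo powers of [p] *)

Section MoritaNat.

Variables (p : nat) (p_pr : prime p) (p_odd : odd p).

(** The sign (-1)^n of Morita's product is spread over the indices 0, ..., n - 1. Index 0 is
    divisible by [p], so it contributes only its sign. *)
Definition morita_factor (i : nat) : int := if (p %| i)%N then -1 else - i%:Z.

Definition morita_int (n : nat) : int := \prod_(0 <= i < n) morita_factor i.

Lemma morita_intS n : morita_int n.+1 = morita_int n * morita_factor n.
Proof. by rewrite /morita_int big_nat_recr. Qed.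

Lemma morita_natE n : morita_nat p_pr n = (morita_int n)%:~R.
Proof.
rewrite /morita_nat; case: n => [|n].
  by rewrite expr0 /morita_int !big_geq ?mulr1.
elim: n => [|n IH].
  by rewrite /morita_int big_geq // big_nat1 /morita_factor dvdn0 mulr1.
rewrite morita_intS rmorphM /= -IH exprS big_mkcond big_nat_recr //= -big_mkcond.
rewrite /morita_factor; case: (p %| n.+1)%N => /=.
  by rewrite rmorphN; ring.
by rewrite rmorphN /=; ring.
Qed.

Lemma morita_factor_eqmod (k i j : nat) : (0 < k)%N ->
  (i = j %[mod p ^ k])%N ->
  (morita_factor i = morita_factor j %[mod (p ^ k)%N])%Z.
Proof.
move=> k0 ij; have pq : (p %| p ^ k)%N by rewrite dvdn_exp.
have pij : (p %| i)%N = (p %| j)%N.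
  by rewrite /dvdn -(modn_dvdm i pq) ij modn_dvdm.
rewrite /morita_factor pij; case: ifP => // _.
by rewrite -modzNm -[in RHS]modzNm !modz_nat ij.
Qed.

Lemma morita_int_fact (m : nat) : (m < p)%N ->
  morita_int m.+1 = (-1) ^+ m.+1 * (m`!)%:Z.
Proof.
elim: m => [|m IH] mp.
  by rewrite /morita_int big_nat1 /morita_factor dvdn0 fact0.
rewrite morita_intS IH ?(ltnW mp) // factS /morita_factor gtnNdvd //.
by rewrite [in RHS]exprS PoszM; ring.
Qed.

(** Wilson's theorem: the product is (-1)^p (p - 1)!, and [p] is odd. *)
Lemma morita_int_p : (p %| morita_int p - 1)%Z.
Proof.
have p1 := prime_gt1 p_pr; have := p_pr; rewrite (Wilson p1) => W.
rewrite -[X in morita_int X](prednK (prime_gt0 p_pr)).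
rewrite morita_int_fact; last by lia.
rewrite (prednK (prime_gt0 p_pr)) -signr_odd p_odd expr1 mulN1r -opprD.
by rewrite dvdzE abszN /= addn1.
Qed.

(** Modulo [p] the factors have period [p], so the product is a power of the one over a single
    period. *)
Lemma morita_int_pX_modp (k : nat) : (p %| morita_int (p ^ k.+1) - 1)%Z.
Proof.
have p1 := prime_gt1 p_pr.
rewrite -intr_Zp_eq0 // rmorphB rmorph1 /morita_int rmorph_prod /= expnS.
rewrite prod_periodic => [|i].
  rewrite -rmorph_prod /=; move: morita_int_p; rewrite -intr_Zp_eq0 // rmorphB.
  by rewrite rmorph1 subr_eq0 => /eqP ->; rewrite expr1n subrr.
apply/eqP; rewrite -subr_eq0 -rmorphB /= intr_Zp_eq0 // -eqz_mod_dvd.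
apply/eqP; have := @morita_factor_eqmod 1 (i + p)%N i.
by rewrite expn1 modnDr; apply.
Qed.

(** Up to sign this is the product of all units of Z/p^(k+1). Inversion permutes them, so the
    product is its own inverse. *)
Lemma morita_int_pX_sqr (k : nat) :
  ((p ^ k.+1)%N %| morita_int (p ^ k.+1) ^+ 2 - 1)%Z.
Proof.
have p1 := prime_gt1 p_pr; set q := (p ^ k.+1)%N.
have q1 : (1 < q)%N by rewrite -(exp1n k.+1) ltn_exp2r.
rewrite -intr_Zp_eq0 // rmorphB rmorph1 rmorphXn /= subr_eq0.
have -> : (morita_int q)%:~R =
    \prod_(x : 'Z_q) (if x \is a GRing.unit then - x else -1).
  transitivity (\prod_(0 <= i < (Zp_trunc q).+2) (morita_factor i)%:~R : 'Z_q).
    by rewrite /morita_int rmorph_prod Zp_cast.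
  rewrite big_mkord; apply: eq_bigr => i _.
  rewrite -[in RHS](natr_Zp i) unitZpE // /q coprime_pexpl // prime_coprime //.
  by rewrite /morita_factor if_neg; case: ifP => _; rewrite rmorphN.
(* The reindexing x -> x^-1 fixes the nonunits, since there x^-1 = x. *)
have E : \prod_(x : 'Z_q) (if x \is a GRing.unit then - x else -1) =
    \prod_(x : 'Z_q) (if x \is a GRing.unit then - x^-1 else -1).
  rewrite [LHS](reindex_inj (@invr_inj 'Z_q)) /=.
  by apply: eq_bigr => x _; rewrite unitrV.
rewrite expr2 {2}E -big_split /= big1 // => x _.
case: ifP => [ux|_]; last by rewrite mulrNN mulr1.
by rewrite mulrNN divrr.
Qed.

(** With g the product, p^k divides (g - 1)(g + 1). As [p] is odd and divides g - 1, it is prime to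
    g + 1, so p^k divides g - 1. *)
Lemma morita_int_pX (k : nat) : (morita_int (p ^ k) = 1 %[mod (p ^ k)%N])%Z.
Proof.
case: k => [|k]; first by rewrite !modz1.
apply/eqP; rewrite eqz_mod_dvd.
have := morita_int_pX_sqr k; rewrite subr_sqr_1 Gauss_dvdzl //.
rewrite coprimezE /= coprimeXl // prime_coprime //; apply/negP => pD.
have pB := morita_int_pX_modp k; set g := morita_int _ in pD pB.
have : (p %| (g + 1) - (g - 1))%Z by apply: rpredB.
have -> : (g + 1) - (g - 1) = 2%:Z :> int by ring.
rewrite dvdzE /= => /dvdn_leq; have := prime_gt1 p_pr; lia.
Qed.

Lemma morita_int_periodic (k n : nat) :
  (morita_int (n + p ^ k) = morita_int n %[mod (p ^ k)%N])%Z.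
Proof.
case: k => [|k]; first by rewrite !modz1.
elim: n => [|n IH]; first by rewrite add0n morita_int_pX /morita_int big_geq.
rewrite addSn !morita_intS -modzMm IH.
rewrite (@morita_factor_eqmod k.+1 _ n) ?modzMm //.
by rewrite modnDr.
Qed.

(** This is the uniform continuity that makes the limit defining the gamma function exist. *)
Lemma morita_int_eqmod (k m n : nat) : (m = n %[mod p ^ k])%N ->
  (morita_int m = morita_int n %[mod (p ^ k)%N])%Z.
Proof.
have red j : (morita_int j = morita_int (j %% p ^ k)%N %[mod (p ^ k)%N])%Z.
  rewrite [in LHS](divn_eq j (p ^ k)); elim: (_ %/ _)%N => [|c IH].
    by rewrite mul0n.
  by rewrite mulSn -addnA addnC morita_int_periodic.
by move=> mn; rewrite red mn -red.
Qed.

(** As [p] is odd, a class modulo [p] has no parity of its own; its representative in 1, ..., p has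
    one, with [p] standing for the class 0. *)
Lemma signr_eqmod_odd (m a : nat) : (m = a %[mod p])%N -> (0 < a <= p)%N ->
  (-1) ^+ a = (-1) ^+ (if (p %| m)%N then p else m %% p)%N :> int.
Proof.
rewrite /dvdn => ->; case: (ltngtP a p) => [ap /andP[a0 _]|_ /andP[]|-> _] //.
  by rewrite modn_small // eqn0Ngt a0.
by rewrite modnn eqxx.
Qed.

(** Induction on [m] with the sum fixed: each step trades the factor at [n] for the one at [m],
    where m + n is 0 modulo p^k. These two factors are opposite if prime to [p], and otherwise both
    are -1. *)
Lemma morita_int_reflect (k m n a : nat) : (0 < k)%N ->
  (m + n = 1 %[mod p ^ k])%N -> (m = a %[mod p])%N -> (0 < a <= p)%N ->
  (morita_int m * morita_int n = (-1) ^+ a %[mod (p ^ k)%N])%Z.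
Proof.
move=> k0; have p1 := prime_gt1 p_pr.
elim: m n a => [|m IH] n a mn ma a_bd.
  have -> : (-1) ^+ a = -1 :> int.
    by rewrite (@signr_eqmod_odd 0) // dvdn0 -signr_odd p_odd.
  have -> : morita_int 0 = 1 by rewrite /morita_int big_geq.
  rewrite add0n in mn; rewrite mul1r (morita_int_eqmod mn) /morita_int big_nat1.
  by rewrite /morita_factor dvdn0.
(* [b] is the exponent belonging to [m]. It is a - 1, unless [p] divides [m]: then b = p and a = 1,
   which are both odd. *)
pose b := if (p %| m)%N then p else (m %% p)%N.
have mb : (m = b %[mod p])%N.
  by rewrite /b; case: ifP => [/eqP ->|_]; rewrite ?modnn ?modn_mod.
have b_bd : (0 < b <= p)%N.
  rewrite /b /dvdn; case: ifP => [_|/negbT]; first by rewrite prime_gt0 /=.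
  by rewrite -lt0n => ->; rewrite ltnW // ltn_mod prime_gt0.
have {IH} := IH n.+1 b; rewrite addnS -addSn => /(_ mn mb b_bd).
rewrite morita_intS mulrA => IH.
have mnq : (p ^ k %| m + n)%N.
  have : (1 + (m + n) == 1 + 0 %[mod p ^ k])%N by rewrite addnA add1n mn.
  by rewrite eqn_modDl mod0n.
have mnp : (p %| m + n)%N by apply: dvdn_trans mnq; rewrite dvdn_exp.
have pn : (p %| n)%N = (p %| m)%N.
  by apply/idP/idP => h; [rewrite -(dvdn_addl _ h)|rewrite -(dvdn_addr _ h)].
have hn : (morita_factor n * (-1) ^+ a =
    morita_factor m * (-1) ^+ b %[mod (p ^ k)%N])%Z.
  rewrite /morita_factor pn; have [pm|pm] := boolP (p %| m)%N.
    have -> : b = p by rewrite /b pm.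
    have -> : a = 1%N.
      apply: (eqmod_small_pos a_bd); first by rewrite /= prime_gt0.
      by rewrite -ma -addn1 -modnDml (eqP pm).
    by rewrite -[in RHS]signr_odd p_odd.
  have bE : b = (m %% p)%N by rewrite /b (negbTE pm).
  have bp : (b < p)%N by rewrite bE ltn_mod ltnW.
  have -> : a = b.+1.
    apply: (@eqmod_small_pos p a b.+1 a_bd bp).
    by rewrite -ma -addn1 -modnDml mb modnDml addn1.
  rewrite exprS; apply/eqP; rewrite eqz_mod_dvd.
  have -> : - n%:Z * (-1 * (-1) ^+ b) - - m%:Z * (-1) ^+ b =
      (m + n)%:Z * (-1) ^+ b.
    by rewrite PoszD; ring.
  by rewrite dvdz_mulr // dvdzE.
(* Every factor is prime to [p], so the one at [n] can be cancelled from the congruence. *)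
have cop : coprimez (p ^ k)%N (morita_factor n).
  rewrite coprimezE coprimeXl // prime_coprime // /morita_factor.
  by case: ifP; rewrite ?abszN /= ?dvdn1 ?gtn_eqF // => ->.
apply/eqP; rewrite eqz_mod_dvd -(Gauss_dvdzl _ cop) mulrBl -eqz_mod_dvd.
apply/eqP; rewrite [X in _ = (X %% _)%Z]mulrC hn morita_intS.
rewrite -[in RHS]modzMmr -IH modzMmr.
by congr (_ %% _)%Z; ring.
Qed.

End MoritaNat.

(** * Passage to [p]-adic arguments and the reflection formula *)

Section PadicGamma.

Variables (p : nat) (p_pr : prime p).

Local Notation Zp := (padic_int p_pr).

Lemma padic_resM (x y : Zp) k : (x * y) k = (x k * y k %% (p ^ k)%N)%Z.
Proof. by []. Qed.

Lemma padic_res_nat (n k : nat) : (n%:R : Zp) k = (n%:Z %% (p ^ k)%N)%Z.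
Proof.
elim: n => [|n IH] //; rewrite mulrSr.
transitivity (((n%:R : Zp) k + (1 %% (p ^ k)%N)%Z) %% (p ^ k)%N)%Z => //.
by rewrite IH modzDm -addn1 PoszD.
Qed.

Lemma padic_res_int (z : int) (k : nat) :
  (z%:~R : Zp) k = (z %% (p ^ k)%N)%Z.
Proof.
case: z => n; first exact: padic_res_nat.
rewrite NegzE mulrNz.
transitivity (- (n.+1%:R : Zp) k %% (p ^ k)%N)%Z => //.
by rewrite padic_res_nat modzNm.
Qed.

Lemma padic_res_le (x : Zp) (j k : nat) : (j <= k)%N ->
  (x k %% (p ^ j)%N)%Z = x j.
Proof. by move=> jk; rewrite -[X in x X](subnK jk) padic_resD. Qed.

Lemma padic_res_absz (x : Zp) (k : nat) : `|x k|%N%:Z = x k.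
Proof.
rewrite -(padic_res_mod x k) gez0_abs // modz_ge0 //.
by rewrite -lt0n expn_gt0 prime_gt0.
Qed.

Lemma padic_nat_approx (x : Zp) (k : nat) :
  exists n : nat, forall j, (j <= k)%N -> (n%:R : Zp) j = x j.
Proof.
exists `|x k|%N => j jk.
by rewrite padic_res_nat padic_res_absz padic_res_le.
Qed.

Lemma padic_nat_unit (D : nat) : ~~ (p %| D)%N ->
  (D%:R : Zp) \is a GRing.unit.
Proof.
move=> pD.
have cop k : coprimez (p ^ k)%N D.
  by rewrite coprimezE /= coprimeXl // prime_coprime.
(* The Bezout coefficient of [D] inverts it modulo p^k; these inverses are compatible because [D]
   can be cancelled. *)
pose f k := (egcdz (p ^ k)%N D).2.
have fD k : (f k * D = 1 %[mod (p ^ k)%N])%Z.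
  rewrite /f; case: egcdzP => u v + _ /=; rewrite (eqP (cop k)) => <-.
  by rewrite modzMDl.
have hf k : (f k.+1 = f k %[mod (p ^ k)%N])%Z.
  apply/eqP; rewrite eqz_mod_dvd -(Gauss_dvdzl _ (cop k)) mulrBl -eqz_mod_dvd.
  apply/eqP; rewrite fD -(padic_modS p _ k) fD padic_modS //.
apply/unitrP; exists (padic_of p_pr hf); rewrite mulrC; split=> //.
all: apply: padicP => k; rewrite padic_resM padic_res_nat /= modzMm mulrC fD //.
Qed.

(** In Z_p, [ratr] behaves as a quotient only if the reduced denominator is a unit. Here that
    denominator divides [D], which is prime to [p]. *)
Lemma ratr_mul_nat (u : rat) (N : int) (D : nat) : ~~ (p %| D)%N ->
  u * D%:R = N%:~R -> (ratr u : Zp) * D%:R = N%:~R.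
Proof.
move=> pD uDN.
have E : numq u * D = N * denq u.
  by apply: (@intr_inj rat); rewrite !rmorphM /= -uDN numqE mulrAC.
have dD : (`|denq u| %| D)%N.
  have : (denq u %| numq u * D)%Z by rewrite E dvdz_mull.
  by rewrite Gauss_dvdzr 1?coprimez_sym ?coprimezE ?coprime_num_den // dvdzE.
have ud : ((denq u)%:~R : Zp) \is a GRing.unit.
  rewrite -absz_denq padic_nat_unit //.
  by apply: contra pD => /dvdn_trans; apply.
by rewrite /ratr mulrAC -[D%:R]/((D%:Z)%:~R) -rmorphM /= E rmorphM /= mulrK.
Qed.

Hypothesis p_odd : odd p.

Lemma morita_gammaE (y : Zp) (k n : nat) : (n%:R : Zp) k = y k ->
  morita_gamma y k = (morita_int p n %% (p ^ k)%N)%Z.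
Proof.
have congr_nat j m m' : (m%:R : Zp) j = (m'%:R : Zp) j ->
    morita_nat p_pr m j = morita_nat p_pr m' j.
  rewrite !padic_res_nat !morita_natE !padic_res_int !modz_nat => -[].
  exact: morita_int_eqmod.
(* The limit is read off along the residues of [y], natural numbers converging to [y]. *)
have lim_ex : exists l : Zp, forall j, exists m, forall n : nat,
    (n%:R : Zp) m = y m -> morita_nat p_pr n j = l j.
  have hf j : (morita_nat p_pr `|y j.+1| j.+1 = morita_nat p_pr `|y j| j
      %[mod (p ^ j)%N])%Z.
    rewrite padic_resP padic_res_mod; apply: congr_nat.
    by rewrite !padic_res_nat !padic_res_absz padic_resP padic_res_mod.
  exists (padic_of p_pr hf) => j; exists j => m my.
  rewrite -[RHS]/(morita_nat p_pr `|y j| j %% (p ^ j)%N)%Z padic_res_mod.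
  apply: congr_nat.
  by rewrite my padic_res_nat padic_res_absz padic_res_mod.
rewrite /morita_gamma; case: xgetP => [l _ /= l_lim|no_lim]; last first.
  by case: lim_ex => l /no_lim.
move=> ny; have [m lm] := l_lim k.
(* The precision [m] supplied by the limit may differ from [k], so [n'] approximates [y] to both and
   links the limit to [n]. *)
have [n' n'y] := padic_nat_approx y (maxn m k).
rewrite -padic_res_int -morita_natE -(lm n') ?n'y ?leq_maxl //.
by apply: congr_nat; rewrite ny n'y ?leq_maxr.
Qed.

(** Natural approximations of [y] and 1 - y add up to 1 modulo p^(k+1), which reduces the claim to
    [morita_int_reflect]. *)
Lemma morita_gamma_reflect (y : Zp) (a : nat) :
  (a%:R : Zp) 1%N = y 1%N -> (0 < a <= p)%N ->
  morita_gamma y * morita_gamma (1 - y) = (-1) ^+ a.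
Proof.
move=> ay a_bd; apply: padicP => -[|k].
  by rewrite -[LHS]padic_res_mod -[RHS]padic_res_mod !modz1.
have [m my] := padic_nat_approx y k.+1.
have [n ny] := padic_nat_approx (1 - y) k.+1.
rewrite padic_resM (morita_gammaE (my _ _)) // (morita_gammaE (ny _ _)) //.
rewrite modzMm.
have -> : (-1) ^+ a = ((-1) ^+ a)%:~R :> Zp by rewrite rmorphXn rmorphN.
rewrite padic_res_int; apply: morita_int_reflect => //.
  have : ((m + n)%:R : Zp) k.+1 = (1%:R : Zp) k.+1.
    rewrite natrD; transitivity ((y + (1 - y)) k.+1).
      transitivity
        (((m%:R : Zp) k.+1 + (n%:R : Zp) k.+1) %% (p ^ k.+1)%N)%Z => //.
      by rewrite my // ny.
    by rewrite addrC subrK.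
  by rewrite !padic_res_nat !modz_nat => -[].
have := my 1%N isT; rewrite -ay !padic_res_nat !modz_nat expn1.
by case.
Qed.

(** Since u = N/D with [D] prime to [p], the divisibility condition says that [a] represents [u]
    modulo [p]. *)
Lemma gammaQ_reflect (u : rat) (N : int) (D a : nat) : ~~ (p %| D)%N ->
  u * D%:R = N%:~R -> (0 < a <= p)%N -> (p %| a%:Z * D - N)%Z ->
  gammaQ p_pr u * gammaQ p_pr (1 - u) = (-1) ^+ a.
Proof.
move=> pD uDN a_bd aDN.
have uD := ratr_mul_nat pD uDN; have unD := padic_nat_unit pD.
have r1u : ratr (1 - u) = 1 - ratr u :> Zp.
  apply: (mulIr unD); rewrite (@ratr_mul_nat _ (D%:Z - N) D) //.
    by rewrite mulrBl mul1r uD rmorphB.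
  by rewrite mulrBl mul1r uDN rmorphB.
rewrite /gammaQ r1u -tofracM; move: (ratr u : Zp) uD => y yD.
rewrite (@morita_gamma_reflect _ a) //.
  by rewrite tofracXn tofracN tofrac1.
have : (y * D%:R) 1%N = (N%:~R : Zp) 1%N by rewrite yD.
rewrite padic_resM padic_res_nat padic_res_int expn1 modzMmr => yDN_modp.
rewrite padic_res_nat -padic_res_mod expn1; apply/eqP.
rewrite eqz_mod_dvd -(@Gauss_dvdzl p%:Z _ D%:Z); last first.
  by rewrite coprimezE /= prime_coprime.
by rewrite mulrBl -eqz_mod_dvd yDN_modp eqz_mod_dvd.
Qed.

End PadicGamma.

(** * Fractional parts and the exponents of the signs *)

Lemma fracQ_eq (u v : rat) (e : int) :
  0 <= v < 1 -> v = u + e%:~R -> fracQ u = v.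
Proof.
move=> v01 vE; rewrite /fracQ (@floor_def _ u (- e)).
  by rewrite rmorphN opprK.
move: v01; rewrite vE rmorphD rmorphN /=; lra.
Qed.

(** The integer equalities record that the natural subtractions are not truncated. They give a1 + a2
    = 2j + 1 + e1 + e2 + p(1 - e1 - e2), which is even because [p] is odd. *)
Lemma reflect_exponents (p m j : nat) :
  odd p -> (0 < m)%N -> (2 * m < p)%N -> (j < p.-1)%N ->
  let e1 : nat := (m <= j)%N in
  let e2 : nat := (p - m <= j)%N in
  let a1 := (m + j + e1 - p * e2)%N in
  let a2 := (1 + j + e2 + p * (1 - e1) - m)%N in
  [/\ a1%:Z = m%:Z + j%:Z + e1%:Z - p%:Z * e2%:Z,
      a2%:Z = 1 + j%:Z + e2%:Z + p%:Z * (1 - e1%:Z) - m%:Z,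
      (0 < a1 <= p)%N, (0 < a2 <= p)%N & ~~ odd (a1 + a2)].
Proof.
move=> p_odd m0 mp jp /=.
have [k kE] : exists k, p = (2 * k).+1.
  by exists p./2; rewrite -{1}[p]odd_double_half p_odd mul2n.
case: (leqP m j) => mj; case: (leqP (p - m) j) => pj /=;
  rewrite ?muln0 ?muln1; split; lia.
Qed.

(** * The factors contributed by the two extra parameter pairs *)

Section ParameterPair.

Variables (p : nat) (p_pr : prime p) (p_odd : odd p).

Local Notation gammaQ := (gammaQ p_pr).

Definition mGm_factor (x ak bk : rat) : padic_field p_pr :=
  (- p%:R) ^ (- Num.floor (fracQ ak - x) - Num.floor (fracQ (- bk) + x)) *
  (gammaQ (fracQ (ak - x)) / gammaQ (fracQ ak)) *
  (gammaQ (fracQ (- bk + x)) / gammaQ (fracQ (- bk))).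

Lemma mGm_factorE (m : nat) (a b : m.-tuple rat) (t : 'F_p) :
  mGm p_pr a b t = (-1) / (p.-1)%:R *
    \sum_(0 <= j < p.-1) (-1) ^+ (j * m) * teichmuller_bar p_pr j t *
      \prod_(k < m) mGm_factor (j%:R / (p.-1)%:R) (tnth a k) (tnth b k).
Proof. by []. Qed.

(** The shift [e] turns c - x into its fractional part. The two floors are then [- e] and [e], so
    the power of -p is trivial and the reflection formula gives the sign. *)
Lemma mGm_factor_reflect (c x : rat) (e N : int) (D a : nat) :
  0 < c < 1 -> 0 < c - x + e%:~R < 1 ->
  ~~ (p %| D)%N -> (c - x + e%:~R) * D%:R = N%:~R ->
  (0 < a <= p)%N -> (p %| a%:Z * D - N)%Z ->
  mGm_factor x c c = (-1) ^+ a / (gammaQ c * gammaQ (1 - c)).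
Proof.
move=> c01 u01 pD uDN a_bd aDN; rewrite /mGm_factor; set u := c - x + e%:~R in u01 uDN.
rewrite (@fracQ_eq c c 0) ?addr0 //; last by lra.
rewrite (@fracQ_eq (- c) (1 - c) 1); [|by lra|by rewrite addrC].
rewrite (@fracQ_eq (c - x) u e) //; last by lra.
rewrite (@fracQ_eq (- c + x) (1 - u) (1 - e));
  [|by lra|by rewrite /u rmorphB; ring].
rewrite (@floor_def _ (c - x) (- e)); last first.
  by move: u01; rewrite /u rmorphD rmorphN /=; lra.
rewrite (@floor_def _ (1 - c + x) e); last first.
  by move: u01; rewrite /u rmorphD /=; lra.
rewrite opprK subrr expr0z mul1r mulrACA -invfM.
by rewrite (gammaQ_reflect p_pr p_odd pD uDN a_bd aDN).
Qed.

Lemma mGm_factor_pair (d : nat) (d_gt2 : (2 < d)%N)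
    (p_mod_d : (p%:Z = - 1 %[mod d%:Z])%Z) (j : nat) (jp : (j < p.-1)%N) :
  let x := j%:R / (p.-1)%:R in
  mGm_factor x (1 / d%:R) (1 / d%:R) *
  mGm_factor x ((d%:R - 1) / d%:R) ((d%:R - 1) / d%:R) = 1.
Proof.
set P := p.-1 => x; rewrite {}/x.
have p1 := prime_gt1 p_pr; have pE : p = P.+1 by rewrite prednK // prime_gt0.
have [m md] : exists m, (m * d = p.+1)%N.
  move/eqP: p_mod_d; rewrite eqz_mod_dvd opprK dvdzE /= addn1 => /dvdnP[m mE].
  by exists m.
clear p_mod_d.
have m0 : (0 < m)%N by case: (m) md.
have mp : (2 * m < p)%N.
  have p_neq2 : p != 2%N by apply: contraL p_odd => /eqP ->.
  have : (m * 3 <= m * d)%N by rewrite leq_mul2l d_gt2 orbT.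
  rewrite md; lia.
have pd : ~~ (p %| d)%N.
  apply/negP => /(dvdn_mull m); rewrite md -addn1 dvdn_addr // dvdn1.
  by move/eqP => p1'; rewrite p1' in p1.
have pD : ~~ (p %| d * P)%N.
  by rewrite Euclid_dvdM // negb_or pd gtnNdvd //; lia.
have c01 : 0 < (1 / d%:R : rat) < 1.
  have d_gt0 : (0 < d)%N by lia.
  by rewrite div1r invr_gt0 ltr0n d_gt0 invf_lt1 ?ltr0n // ltr1n ltnW.
have d0 : d%:R != 0 :> rat by rewrite pnatr_eq0; lia.
have P0 : P%:R != 0 :> rat by rewrite pnatr_eq0; lia.
have dP0 : (0 : rat) < (d * P)%:R by rewrite ltr0n muln_gt0; lia.
(* The fractional parts of 1/d - x and (d - 1)/d - x are 1/d - x + e1 and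
   (d - 1)/d - x + e2, and N1, N2 are their numerators over d (p - 1). As
   1/d = m and x = - j mod p, they are congruent to a1 and a2 mod p. *)
pose e1 : nat := (m <= j)%N; pose e2 : nat := (p - m <= j)%N.
pose N1 : int := P%:Z - j%:Z * d + e1%:Z * d * P.
pose N2 : int := d%:Z * P - P%:Z - j%:Z * d + e2%:Z * d * P.
have jd_bd : (j * d + d <= d * P)%N by rewrite -mulSnr mulnC leq_mul2l jp orbT.
have Pd_bd : (3 * P <= d * P)%N by rewrite leq_mul2r d_gt2 orbT.
(* As d > 2, P/d = m - 2/d lies strictly between m - 1 and m, and (d - 1)P/d strictly between p - m
   - 1 and p - m. Hence the thresholds for [j] in [e1] and [e2]. *)
have N1_bd : 0 < N1 < (d * P)%:Z.
  rewrite /N1 /e1; case: (leqP m j) => mj /=.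
    have : (m * d <= j * d)%N by rewrite leq_mul2r mj orbT.
    lia.
  have : (j.+1 * d <= m * d)%N by rewrite leq_mul2r mj orbT.
  rewrite mulSn; lia.
have N2_bd : 0 < N2 < (d * P)%:Z.
  rewrite /N2 /e2; case: (leqP (p - m) j) => mj /=.
    have : (p * d <= (m + j) * d)%N by rewrite leq_mul2r -leq_subLR mj orbT.
    rewrite pE mulSn mulnDl; lia.
  have : ((j + m) * d <= P * d)%N by rewrite leq_mul2r; lia.
  rewrite mulnDl; lia.
pose a1 := (m + j + e1 - p * e2)%N.
pose a2 := (1 + j + e2 + p * (1 - e1) - m)%N.
have bd01 (N : int) (u : rat) :
  0 < N < (d * P)%:Z -> u * (d * P)%:R = N%:~R -> 0 < u < 1.
  move=> /andP[N0 ND] uN; rewrite -(pmulr_lgt0 _ dP0) uN ltr0z N0 /=.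
  by rewrite -(ltr_pM2r dP0) uN mul1r -[X in _ < X]/((d * P)%:Z%:~R) ltr_int.
have E1 : (1 / d%:R - j%:R / P%:R + e1%:Z%:~R) * (d * P)%:R = N1%:~R :> rat.
  by rewrite /N1; field; apply/andP.
have E2 : ((d%:R - 1) / d%:R - j%:R / P%:R + e2%:Z%:~R) * (d * P)%:R =
    N2%:~R :> rat.
  by rewrite /N2; field; apply/andP.
have mdZ : m%:Z * d%:Z = P%:Z + 2 by rewrite -PoszM md pE; lia.
have [] := reflect_exponents p_odd m0 mp jp.
rewrite -/e1 -/e2 -/a1 -/a2 => a1E a2E a1_bd a2_bd a12.
(* The quotients below come from expanding with m d = P + 2 and p = P + 1. *)
have a1D : (p %| a1%:Z * (d * P)%N - N1)%Z.
  apply/dvdzP; exists (P%:Z + j%:Z * d - e2%:Z * d * P).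
  by rewrite a1E /N1 PoszM pE -addn1 PoszD; ring: mdZ.
have a2D : (p %| a2%:Z * (d * P)%N - N2)%Z.
  apply/dvdzP; exists (j%:Z * d - P%:Z + (1 - e1%:Z) * d * P).
  by rewrite a2E /N2 PoszM pE -addn1 PoszD; ring: mdZ.
have cE : (d%:R - 1) / d%:R = 1 - 1 / d%:R :> rat by field.
rewrite (@mGm_factor_reflect (1 / d%:R) _ e1 N1 (d * P) a1) //;
  last first.
- exact: bd01 N1_bd E1.
rewrite (@mGm_factor_reflect ((d%:R - 1) / d%:R) _ e2 N2 (d * P) a2)
  //; last 2 first.
- by rewrite cE; lra.
- exact: bd01 N2_bd E2.
(* Both denominators are Gamma(1/d) Gamma(1 - 1/d), which is (-1)^m because m d - 1 = p; their
   product is therefore 1. *)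
have -> : 1 - (d%:R - 1) / d%:R = 1 / d%:R :> rat by rewrite cE; ring.
rewrite cE [X in _ * (_ / X)]mulrC (@gammaQ_reflect _ p_pr p_odd _ 1 d m) //;
  last 3 first.
- by rewrite divfK.
- by rewrite m0 (leq_trans _ (ltnW mp)) // leq_pmull.
- by rewrite -PoszM md -addn1 PoszD addrK dvdzz.
have even1 k : ~~ odd k -> (-1) ^+ k = 1 :> padic_field p_pr.
  by move=> kE; rewrite -signr_odd (negbTE kE).
by rewrite mulrACA -invfM -!exprD addnn !even1 ?odd_double // divr1.
Qed.

End ParameterPair.

(* The bound 2 < d is needed: for d = 1 the two extra parameter pairs multiply
   every term but the first by p^2, and for d = 2 they multiply the middle term
   by p^-2, so the identity fails for these two values of d. *)
Theorem theorem1p2 (p : nat) (p_pr : prime p) (p_odd : odd p)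
    (n : nat) (n_gt0 : (0 < n)%N) (a b : n.-tuple rat)
    (a_Zp : forall k : 'I_n, rat_in_Zp p_pr (tnth a k))
    (b_Zp : forall k : 'I_n, rat_in_Zp p_pr (tnth b k))
    (d : nat) (d_gt2 : (2 < d)%N) (p_mod_d : (p%:Z = - 1 %[mod d%:Z])%Z)
    (t : 'F_p) :
  @mGm p p_pr (n + 2)
    (cat_tuple a [tuple 1 / d%:R; (d%:R - 1) / d%:R])
    (cat_tuple b [tuple 1 / d%:R; (d%:R - 1) / d%:R]) t
  = mGm p_pr a b t.
Proof.
rewrite !mGm_factorE; congr (_ * _); apply: eq_big_nat => j /andP[_ jp].
by rewrite signr_mulnD2 prod_cat_tuple2 mGm_factor_pair // mulr1.
Qed.
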